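(* Let $\mathcal K$ be a smooth conic in the complex projective plane $\mathbb P^2$, and let $A,B,C,D,E,F$ be six distinct points on $\mathcal K$ in ricochet configuration, meaning the following: if $V$ is the intersection point of the tangents to $\mathcal K$ at $A$ and $C$, then $F$ is the second intersection point of the line $VD$ with $\mathcal K$; and if $W=AF\cap CD$ and $Z$ is the second intersection point of the line $VB$ with $\mathcal K$, then $E$ is the second intersection point of the line $WZ$ with $\mathcal K$. Then both the Pascals $$\left\{\begin{array}{ccc} A&B&C\\ F&E&D\end{array}\right\},\qquad \left\{\begin{array}{ccc} A&E&C\\ D&B&F\end{array}\right\}$$ coincide with the line $VW$.
   Context: Given six distinct points $X_1,X_2,X_3,Y_1,Y_2,Y_3$ on a smooth conic $\mathcal K\subset\mathbb P^2$ (over $\mathbb C$), Pascal's theorem says that the three points $X_1Y_2\cap X_2Y_1$, $X_1Y_3\cap X_3Y_1$, $X_2Y_3\cap X_3Y_2$ are collinear; the line containing them is the Pascal line (the Pascal), denoted $\left\{\begin{smallmatrix} X_1&X_2&X_3\\ Y_1&Y_2&Y_3\end{smallmatrix}\right\}$. Here $XY$ denotes the line joining $X$ and $Y$. Second intersection points of a line with $\mathcal K$ are taken with multiplicity (so $E=Z$ if $WZ$ is tangent to $\mathcal K$ at $Z$). *)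

(* Defs.v *)
From HB Require Import structures.
From mathcomp Require Import all_boot all_order all_algebra.
From mathcomp Require Import reals.
From mathcomp Require Import complex.

Set Implicit Arguments.
Unset Strict Implicit.
Unset Printing Implicit Defensive.
Import GRing.Theory.
Local Open Scope ring_scope.

(* The projective plane over F is the set of 1-dimensional subspaces of F^3.
   Lines are subspaces of dimension 2, so that the join of two distinct points
   is their sum (U + V)%VS, the intersection of two lines is (L :&: M)%VS, and
   incidence is (P <= L)%VS. *)
Record point (F : fieldType) := Point {
  point_space :> {vspace 'rV[F]_3};
  _ : \dim point_space == 1%N
}.

HB.instance Definition _ (F : fieldType) := [isSub for @point_space F].
HB.instance Definition _ (F : fieldType) := [Equality of point F by <:].

(* A conic is given by a 3 x 3 matrix Q, with equation x *m Q *m x^T = 0; every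
   ternary quadratic form arises in this way and Q need not be symmetric. *)
Definition qform (R : comNzRingType) (Q : 'M[R]_3) (x : 'rV[R]_3) : R :=
  (x *m Q *m x^T) 0 0.

(* The partial derivatives of qform Q at x. *)
Definition gradient (R : comNzRingType) (Q : 'M[R]_3) (x : 'rV[R]_3) :
    'rV[R]_3 :=
  x *m (Q + Q^T).

(* Jacobian criterion. F is meant to be algebraically closed, so that no
   singular point is missed. The zero form is not smooth. *)
Definition smooth_conic (F : fieldType) (Q : 'M[F]_3) : Prop :=
  forall x : 'rV[F]_3, x != 0 -> qform Q x = 0 -> gradient Q x != 0.

Definition on_conic (F : fieldType) (Q : 'M[F]_3) (P : point F) : Prop :=
  forall x, x \in point_space P -> qform Q x = 0.

(* The line with equation \sum_i (d qform Q / d x_i)(p) * x_i = 0, where p is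
   a vector of homogeneous coordinates of P. *)
Definition tangent (F : fieldType) (Q : 'M[F]_3) (P : point F) :
    {vspace 'rV[F]_3} :=
  lker (linfun (mulmxr (gradient Q (vpick P))^T)).

(* Intersection multiplicity at P of the line L and the conic Q: the order of
   vanishing at t = 0 of qform Q (p + t w), where p spans P and (p, w) is a
   basis of L. It does not depend on the choice of p and w. When L lies on the
   conic the polynomial is 0 and mup takes the junk value 0; this cannot
   happen when the conic is smooth. *)
Definition intersection_mult (F : fieldType) (Q : 'M[F]_3)
    (L : {vspace 'rV[F]_3}) (P : point F) : nat :=
  if (P <= L)%VS then
    mup 0 (qform (map_mx polyC Q)
             (map_mx polyC (vpick P) + 'X *: map_mx polyC (vpick (L :\: P)%VS)))
  else 0%N.

(* Y is the second intersection point of the line L with the conic Q, the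
   first one being X: the intersection cycle of L and Q is X + Y. *)
Definition second_intersection (F : fieldType) (Q : 'M[F]_3)
    (L : {vspace 'rV[F]_3}) (X Y : point F) : Prop :=
  forall P : point F, intersection_mult Q L P = ((P == X) + (P == Y))%N.

(* The Pascal line: the span of the three collinear points X1Y2 /\ X2Y1,
   X1Y3 /\ X3Y1 and X2Y3 /\ X3Y2. These are pairwise distinct when the X_i and
   Y_i are six distinct points of a smooth conic, so by Pascal's theorem this
   span is the unique line that contains them. *)
Definition pascal (F : fieldType) (X1 X2 X3 Y1 Y2 Y3 : point F) :
    {vspace 'rV[F]_3} :=
  ((X1 + Y2) :&: (X2 + Y1) + (X1 + Y3) :&: (X3 + Y1)
   + (X2 + Y3) :&: (X3 + Y2))%VS.

(* Main.v *)
Require Import Defs.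
From HB Require Import structures.
From mathcomp Require Import all_boot all_order all_algebra.
From mathcomp Require Import reals.
From mathcomp Require Import complex.
From mathcomp Require Import ring.

Set Implicit Arguments.
Unset Strict Implicit.
Unset Printing Implicit Defensive.
Import GRing.Theory.
Local Open Scope ring_scope.

(* Over any field, take vectors a, v, c spanning A, V, C. As V is the pole of AC,
   a can be rescaled so that the conic becomes y^2 = x z in the coordinates
   x a + y v + z c; its points other than C are then (1, t, t^2), and A is t = 0.
   A line through V exchanges t and -t. Hence, if B, D, E have parameters b, d, e,
   then F is -d, Z is -b, W = (1, d, -d^2), the line VW is z = - d^2 x, and the
   collinearity of W, Z, E (or the tangency of WZ if E = Z) reads
   e (b + d) = d (b - d). This relation puts the three vertices of the first
   Pascal on VW. It is invariant under (b, d, e) |-> (e, -d, b), which exchanges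
   the two Pascals. *)

(** * The polar form of a conic *)

(** The polarization of [qform Q], without the factor 1/2, so that it makes sense in every
    characteristic. *)
Definition polar (R : comNzRingType) (Q : 'M[R]_3) (x y : 'rV[R]_3) : R :=
  (gradient Q x *m y^T) 0 0.

Lemma polarDl (R : comNzRingType) (Q : 'M[R]_3) x y z :
  polar Q (x + y) z = polar Q x z + polar Q y z.
Proof. by rewrite /polar /gradient !mulmxDl mxE. Qed.

Lemma polarZl (R : comNzRingType) (Q : 'M[R]_3) k x y :
  polar Q (k *: x) y = k * polar Q x y.
Proof. by rewrite /polar /gradient -!scalemxAl mxE. Qed.

Lemma polarC (R : comNzRingType) (Q : 'M[R]_3) x y :
  polar Q x y = polar Q y x.
Proof.
rewrite /polar /gradient -[in LHS](trmxK (_ *m _)) [in LHS]mxE.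
by rewrite !trmx_mul trmxK linearD /= trmxK (addrC Q^T) mulmxA.
Qed.

Lemma polarDr (R : comNzRingType) (Q : 'M[R]_3) x y z :
  polar Q z (x + y) = polar Q z x + polar Q z y.
Proof. by rewrite !(polarC Q z) polarDl. Qed.

Lemma polarZr (R : comNzRingType) (Q : 'M[R]_3) k x y :
  polar Q x (k *: y) = k * polar Q x y.
Proof. by rewrite !(polarC Q x) polarZl. Qed.

Lemma polarE (R : comNzRingType) (Q : 'M[R]_3) x y :
  polar Q x y = (x *m Q *m y^T) 0 0 + (y *m Q *m x^T) 0 0.
Proof.
rewrite /polar /gradient mulmxDr mulmxDl mxE; congr (_ + _).
by rewrite -[in LHS](trmxK (_ *m _)) [in LHS]mxE !trmx_mul !trmxK mulmxA.
Qed.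

Lemma polar_diag (R : comNzRingType) (Q : 'M[R]_3) x :
  polar Q x x = 2 * qform Q x.
Proof. by rewrite polarE mulr_natl. Qed.

Lemma qformD (R : comNzRingType) (Q : 'M[R]_3) x y :
  qform Q (x + y) = qform Q x + qform Q y + polar Q x y.
Proof.
rewrite polarE /qform linearD /= !mulmxDl !mulmxDr.
by rewrite mxE [in LHS]mxE [X in _ + X]mxE; ring.
Qed.

Lemma qformZ (R : comNzRingType) (Q : 'M[R]_3) k x :
  qform Q (k *: x) = k ^+ 2 * qform Q x.
Proof. by rewrite /qform linearZ /= -scalemxAr -!scalemxAl !mxE mulrA expr2. Qed.

(** * Points, lines and intersection multiplicities *)

Lemma qform_polyC (F : fieldType) (Q : 'M[F]_3) x :
  qform (map_mx polyC Q) (map_mx polyC x) = (qform Q x)%:P.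
Proof. by rewrite /qform map_trmx -!map_mxM mxE. Qed.

Lemma polar_polyC (F : fieldType) (Q : 'M[F]_3) x y :
  polar (map_mx polyC Q) (map_mx polyC x) (map_mx polyC y) = (polar Q x y)%:P.
Proof. by rewrite /polar /gradient !map_trmx -map_mxD -!map_mxM mxE. Qed.

Lemma coef_lt_mup0 (F : fieldType) (p : {poly F}) i :
  (i < mup 0 p)%N -> p`_i = 0.
Proof.
have [->|p0] := eqVneq p 0; first by rewrite coef0.
rewrite mup_geq // subr0 => /dvdpP [r ->].
by rewrite coefMXn ltnSn.
Qed.

Lemma point_vpick (F : fieldType) (P : point F) :
  vpick P != 0 /\ point_space P = <[vpick P]>%VS.
Proof.
case: P => U /= /eqP dU.
have U0 : vpick U != 0 by rewrite vpick0 -dimv_eq0 dU.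
by split=> //; apply/esym/eqP; rewrite eqEdim dim_vline U0 dU -memvE memv_pick.
Qed.

Lemma point_lineE (F : fieldType) (P : point F) p :
  p \in point_space P -> p != 0 -> point_space P = <[p]>%VS.
Proof.
case: P => U /= /eqP dU pU p0.
by apply/esym/eqP; rewrite eqEdim dim_vline p0 dU -memvE pU.
Qed.

Lemma memv_line2P (F : fieldType) (vT : vectType F) (x p q : vT) :
  reflect (exists k l, x = k *: p + l *: q) (x \in (<[p]> + <[q]>)%VS).
Proof.
apply: (iffP memv_addP) => [[_ /vlineP[k ->] [_ /vlineP[l ->] ->]]|[k [l ->]]].
  by exists k, l.
by exists (k *: p); [|exists (l *: q) => //]; apply/vlineP; [exists k|exists l].
Qed.

(** The constant coefficient of the polynomial defining the multiplicity is [qform Q] at a spanning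
    vector of P. *)
Lemma intersection_mult_gt0 (F : fieldType) (Q : 'M[F]_3) L (P : point F) :
  (0 < intersection_mult Q L P)%N -> (P <= L)%VS /\ on_conic Q P.
Proof.
rewrite /intersection_mult; case: ifP => // PL /coef_lt_mup0.
rewrite qformD qform_polyC qformZ polarZr expr2 -mulrA.
rewrite !coefD !coefXM coefC /= !addr0 => q0; split=> // x.
by rewrite (point_vpick P).2 => /vlineP[k ->]; rewrite qformZ q0 mulr0.
Qed.

(** The linear coefficient is [polar Q] between the vectors picked in P and in a complement of P in
    L. These two span L, and the first is conjugate to itself since P is on the conic. *)
Lemma intersection_mult_gt1 (F : fieldType) (Q : 'M[F]_3) L (P : point F) p w :
  (\dim L <= 2)%N -> (1 < intersection_mult Q L P)%N ->
  p \in point_space P -> w \in L -> polar Q p w = 0.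
Proof.
move=> dL m1.
have [PL cP] := intersection_mult_gt0 (ltnW m1).
move: m1; rewrite /intersection_mult PL => /coef_lt_mup0.
rewrite qformD qform_polyC qformZ qform_polyC polarZr polar_polyC.
rewrite expr2 -mulrA !coefD !coefXM !coefC /= !add0r => b0.
have dP : \dim P = 1%N by case: (P) => U /= /eqP.
rewrite (point_vpick P).2 => /vlineP[k ->].
have := addv_diff L P; rewrite (addv_idPl PL) => <- /memv_addP[u uD [p' p'P ->]].
(* The complement has dimension at most 1, so the vector picked in it spans it, even when it is
   zero. *)
have [l ->] : exists l, u = l *: vpick (L :\: P)%VS.
  have dD : (\dim (L :\: P) <= 1)%N.
    have := dimv_cap_compl L P.
    by rewrite (capv_idPr PL) dP add1n -ltnS => ->.
  have [D0|D0] := eqVneq (L :\: P)%VS 0%VS.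
    by exists 0; move: uD; rewrite D0 memv0 scale0r => /eqP.
  apply/vlineP; suff -> : <[vpick (L :\: P)]>%VS = (L :\: P)%VS by [].
  by apply/eqP; rewrite eqEdim dim_vline vpick0 D0 dD -memvE memv_pick.
have /vlineP[m ->] : p' \in <[vpick P]>%VS by rewrite -(point_vpick P).2.
rewrite polarZl polarDr !polarZr b0 polar_diag (cP _ (memv_pick _)).
by rewrite !mulr0 addr0 mulr0.
Qed.

Lemma memv_tangent (F : fieldType) (Q : 'M[F]_3) (P : point F) x :
  (x \in tangent Q P) = (polar Q (vpick P) x == 0).
Proof.
rewrite memv_ker lfunE /=.
have -> : polar Q (vpick P) x = (x *m (gradient Q (vpick P))^T) 0 0.
  by rewrite /polar -[in LHS](trmxK (_ *m _)) [in LHS]mxE trmx_mul trmxK.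
apply/eqP/eqP => [->|x0]; first by rewrite mxE.
by rewrite [LHS]mx11_scalar x0 raddf0.
Qed.

(** * Coordinates adapted to two points of the conic and their pole *)

Definition frame (F : fieldType) (a v c : 'rV[F]_3) (x y z : F) : 'rV[F]_3 :=
  x *: a + y *: v + z *: c.

Definition conic_frame (F : fieldType) (Q : 'M[F]_3) (a v c : 'rV[F]_3) :=
  [/\ qform Q a = 0, qform Q c = 0, polar Q a v = 0, polar Q c v = 0 &
   polar Q a c = - qform Q v /\ qform Q v != 0].

Lemma frame_lincomb (F : fieldType) (a v c : 'rV[F]_3) k l x y z x' y' z' :
  k *: frame a v c x y z + l *: frame a v c x' y' z' =
  frame a v c (k * x + l * x') (k * y + l * y') (k * z + l * z').
Proof. by apply/rowP=> i; rewrite !mxE; ring. Qed.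

Lemma polar_frame (F : fieldType) (Q : 'M[F]_3) a v c x y z x' y' z' :
  conic_frame Q a v c ->
  polar Q (frame a v c x y z) (frame a v c x' y' z') =
  qform Q v * (2 * y * y' - x * z' - z * x').
Proof.
case=> qa qc av cv [ac _].
rewrite !(polarDl, polarDr, polarZl, polarZr) !polar_diag.
by rewrite (polarC Q v) (polarC Q c a) (polarC Q v) qa qc av cv ac; ring.
Qed.

Lemma qform_frame (F : fieldType) (Q : 'M[F]_3) a v c x y z :
  conic_frame Q a v c ->
  qform Q (frame a v c x y z) = qform Q v * (y ^+ 2 - x * z).
Proof.
case=> qa qc av cv [ac _].
rewrite !(qformD, polarDl, polarZl, polarZr) !qformZ (polarC Q v) qa qc av cv ac.
by ring.
Qed.

(** Pairing with c and a recovers x and z. Pairing with v would give only 2 y, so y is obtained from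
    v being nonzero, which also covers characteristic 2. *)
Lemma frame_inj (F : fieldType) (Q : 'M[F]_3) a v c x y z x' y' z' :
  conic_frame Q a v c -> frame a v c x y z = frame a v c x' y' z' ->
  [/\ x = x', y = y' & z = z'].
Proof.
move=> fr; have [_ _ _ _ [_ v0]] := fr => eq.
have coord p q r : 2 * y * q - x * r - z * p = 2 * y' * q - x' * r - z' * p.
  by apply: (mulfI v0); rewrite -!(polar_frame _ _ _ _ _ _ fr) eq.
have ex : x = x'.
  by apply: oppr_inj; have := coord 0 0 1; rewrite !(mulr0, mulr1, subr0, sub0r).
have ez : z = z'.
  by apply: oppr_inj; have := coord 1 0 0; rewrite !(mulr0, mulr1, oppr0, add0r).
split=> //; move: eq; rewrite /frame ex ez => /addIr /addrI /eqP.
rewrite -subr_eq0 -scalerBl scaler_eq0 subr_eq0 => /orP[/eqP //|/eqP v00].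
by move: v0; rewrite v00 -(scale0r 0) qformZ expr0n mul0r eqxx.
Qed.

(** Stated from linear independence alone, because it is also applied before [conic_frame] is
    established. *)
Lemma free_frame_surj (F : fieldType) (a v c p : 'rV[F]_3) :
  (forall x y z, frame a v c x y z = 0 -> [/\ x = 0, y = 0 & z = 0]) ->
  exists x y z, p = frame a v c x y z.
Proof.
move=> fr; pose M := \matrix_(i < 3) [tuple a; v; c]`_i.
have mulM (u : 'rV_3) : u *m M = frame a v c (u 0 0) (u 0 1) (u 0 2).
  rewrite mulmx_sum_row !big_ord_recl big_ord0 !rowK /= addr0 addrA.
  by congr (_ *: _ + _ *: _ + _ *: _); congr (u 0 _); apply: val_inj.
have Mfree : row_free M.
  apply: inj_row_free => u; rewrite mulM => /fr [u0 u1 u2].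
  apply/rowP => i; rewrite mxE; case: i => [[|[|[|?]]] h] //;
    [apply: etrans _ u0|apply: etrans _ u1|apply: etrans _ u2];
    by congr (u 0 _); apply: val_inj.
move: Mfree; rewrite row_free_unit => Munit; pose u := p *m invmx M.
by exists (u 0 0), (u 0 1), (u 0 2); rewrite -mulM mulmxKV.
Qed.

Lemma frame000 (F : fieldType) (a v c : 'rV[F]_3) : frame a v c 0 0 0 = 0.
Proof. by rewrite /frame !scale0r !addr0. Qed.

Lemma frame_surj (F : fieldType) (Q : 'M[F]_3) a v c p :
  conic_frame Q a v c -> exists x y z, p = frame a v c x y z.
Proof.
move=> fr; apply: free_frame_surj => x y z.
by rewrite -(frame000 a v c); apply: (frame_inj fr).
Qed.

(** * The parametrized conic, its chords and the lines through V *)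

Definition conic_param (F : fieldType) (a v c : 'rV[F]_3) (t : F) :=
  frame a v c 1 t (t ^+ 2).

Lemma conic_param0 (F : fieldType) (a v c : 'rV[F]_3) : conic_param a v c 0 = a.
Proof. by rewrite /conic_param /frame expr0n !scale0r scale1r !addr0. Qed.

Lemma frame010 (F : fieldType) (a v c : 'rV[F]_3) : frame a v c 0 1 0 = v.
Proof. by rewrite /frame !scale0r scale1r add0r addr0. Qed.

Lemma frame001 (F : fieldType) (a v c : 'rV[F]_3) : frame a v c 0 0 1 = c.
Proof. by rewrite /frame !scale0r scale1r !add0r. Qed.

(** At (1, u, u^2) the left-hand side of this equation is (u - s) (u - t). *)
Lemma mem_chord (F : fieldType) (Q : 'M[F]_3) a v c s t x y z :
  conic_frame Q a v c ->
  frame a v c x y z \in (<[conic_param a v c s]> + <[conic_param a v c t]>)%VS ->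
  s * t * x - (s + t) * y + z = 0.
Proof.
move=> fr /memv_line2P[k [l]]; rewrite frame_lincomb.
by case/(frame_inj fr) => -> -> ->; ring.
Qed.

(** The limit of the chord equation, divided by s, as s goes to infinity. *)
Lemma mem_chord_infty (F : fieldType) (Q : 'M[F]_3) a v c t x y z :
  conic_frame Q a v c ->
  frame a v c x y z \in (<[c]> + <[conic_param a v c t]>)%VS -> y = t * x.
Proof.
move=> fr; rewrite -{2}(frame001 a v c) => /memv_line2P[k [l]].
by rewrite frame_lincomb => /(frame_inj fr) [-> -> _]; ring.
Qed.

(** The point (1, 0, m) is the trace of the line z = m x on the line AC, which is y = 0. *)
Lemma mem_polar_line (F : fieldType) (a v c : 'rV[F]_3) m x y z :
  z = m * x -> frame a v c x y z \in (<[v]> + <[frame a v c 1 0 m]>)%VS.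
Proof.
move=> ->; apply/memv_line2P; exists y, x.
rewrite -{2}(frame010 a v c) frame_lincomb.
by congr frame; ring.
Qed.

Lemma polar_line_shift (F : fieldType) (a v c : 'rV[F]_3) m y :
  (<[v]> + <[frame a v c 1 y m]>)%VS = (<[v]> + <[frame a v c 1 0 m]>)%VS.
Proof.
apply/eqP; rewrite eqEsubv !subv_add !addvSl /= -!memvE.
rewrite mem_polar_line ?mulr1 //=; apply/memv_line2P; exists (- y), 1.
by rewrite -{2}(frame010 a v c) frame_lincomb; congr frame; ring.
Qed.

(** * The first Pascal in coordinates *)

(** Here G stands for the point F of the configuration. Each vertex satisfies z = - d^2 x, and two
    of the vertices already span that line. The parameters are kept general so that the second
    Pascal is another instance. *)
Lemma pascal_conic_frame (F : fieldType) (Q : 'M[F]_3) a v c b d e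
    (A B C D E G : point F) :
  conic_frame Q a v c ->
  point_space A = <[a]>%VS -> point_space C = <[c]>%VS ->
  point_space B = <[conic_param a v c b]>%VS ->
  point_space D = <[conic_param a v c d]>%VS ->
  point_space E = <[conic_param a v c e]>%VS ->
  point_space G = <[conic_param a v c (- d)]>%VS ->
  b != 0 -> d != 0 -> e != 0 -> b != d -> e != d -> b + d != 0 ->
  e * (b + d) = d * (b - d) ->
  pascal A B C G E D = (<[v]> + <[frame a v c 1 0 (- d ^+ 2)]>)%VS.
Proof.
move=> fr eA eC eB eD eE eG b0 d0 e0 bd ed bd0 rel.
have bBd0 : b - d != 0 by rewrite subr_eq0.
have eBd0 : e - d != 0 by rewrite subr_eq0.
have {}eA : point_space A = <[conic_param a v c 0]>%VS by rewrite conic_param0.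
have rel0 : e * (b + d) - d * (b - d) = 0 by rewrite rel subrr.
rewrite /pascal eA eC eB eD eE eG.
apply/eqP; rewrite eqEsubv; apply/andP; split.
  rewrite !subv_add -!andbA; apply/and3P; split; apply/subvP => p;
    have [x [y [z ->]]] := frame_surj p fr; rewrite memv_cap => /andP[].
  - move=> /(mem_chord fr) h1 /(mem_chord fr) h2.
    (* Eliminating y between the equations of AE and BG and multiplying by b + d leaves, modulo the
       relation, a multiple b (b - d) of z + d^2 x up to sign. *)
    apply: mem_polar_line; apply: (mulfI (mulf_neq0 b0 bBd0)); apply: subr0_eq.
    transitivity ((e * (b + d) - d * (b - d)) * (z - b * d * x)
      - (b + d) * (e * (b * - d * x - (b + - d) * y + z)
                   - (b - d) * (0 * e * x - (0 + e) * y + z))); first by ring.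
    by rewrite h1 h2 rel0 !mulr0 mul0r !subrr mulr0 subrr.
  - move=> /(mem_chord fr) h1 /(mem_chord_infty fr) h2.
    apply: mem_polar_line; apply: subr0_eq.
    by rewrite -h1 h2; ring.
  - move=> /(mem_chord fr) h1 /(mem_chord_infty fr) h2.
    apply: mem_polar_line; apply: subr0_eq.
    transitivity ((b * d * x - (b + d) * y + z)
      + (e * (b + d) - d * (b - d)) * x); first by rewrite h2; ring.
    by rewrite h1 rel0 mul0r addr0.
set S := (_ + _ + _)%VS.
(* The line AE is z = e y, so this is its point on z = - d^2 x. *)
have p1S : frame a v c 1 (- d ^+ 2 / e) (- d ^+ 2) \in S.
  apply: (subvP (subv_trans (addvSl _ _) (addvSl _ _))).
  rewrite memv_cap; apply/andP; split; apply/memv_line2P.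
    exists (1 + d ^+ 2 / e ^+ 2), (- (d ^+ 2 / e ^+ 2)).
    by rewrite frame_lincomb; congr frame; field.
  (* The first two coordinates force these coefficients on B and G; the third then agrees by the
     relation. *)
  exists ((d - d ^+ 2 / e) / (b + d)), (1 - (d - d ^+ 2 / e) / (b + d)).
  rewrite frame_lincomb; congr frame; [by ring|by field; rewrite bd0|].
  apply: (mulfI e0); apply: subr0_eq.
  transitivity (- d * (e * (b + d) - d * (b - d))).
    by field; rewrite e0 bd0.
  by rewrite rel0 mulr0.
have p2S : frame a v c 1 (- d) (- d ^+ 2) \in S.
  apply: (subvP (subv_trans (addvSr _ _) (addvSl _ _))).
  rewrite memv_cap; apply/andP; split; apply/memv_line2P.
    by exists 2, (-1); rewrite frame_lincomb; congr frame; ring.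
  exists (- (2 * d ^+ 2)), 1.
  by rewrite -{2}(frame001 a v c) frame_lincomb; congr frame; ring.
(* The two vertices differ only in y, by d (e - d) / e, which is nonzero. *)
have vS : v \in S.
  have k0 : d * (e - d) / e != 0 by rewrite !mulf_neq0 ?invr_eq0.
  have -> : v = (d * (e - d) / e)^-1 *: frame a v c 1 (- d ^+ 2 / e) (- d ^+ 2)
      + (- (d * (e - d) / e)^-1) *: frame a v c 1 (- d) (- d ^+ 2).
    rewrite -[LHS](frame010 a v c) frame_lincomb.
    by congr frame; field; rewrite ?e0 ?d0 ?eBd0.
  by rewrite memvD ?memvZ.
rewrite subv_add -!memvE vS /=.
have -> : frame a v c 1 0 (- d ^+ 2) = d *: v + frame a v c 1 (- d) (- d ^+ 2).
  rewrite -{2}(frame010 a v c) -[X in _ = _ + X]scale1r frame_lincomb.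
  by congr frame; ring.
by rewrite memvD ?memvZ.
Qed.

(** * Existence of the frame and of the parameters *)

Lemma conic_frame_exists (F : fieldType) (Q : 'M[F]_3) (A C V : point F) :
  smooth_conic Q -> on_conic Q A -> on_conic Q C -> A != C ->
  point_space V = (tangent Q A :&: tangent Q C)%VS ->
  exists a v c, [/\ conic_frame Q a v c, point_space A = <[a]>%VS,
    point_space V = <[v]>%VS & point_space C = <[c]>%VS].
Proof.
move=> smoothQ onA onC AC defV.
have memV x : (x \in point_space V)
    = (polar Q (vpick A) x == 0) && (polar Q (vpick C) x == 0).
  by rewrite defV memv_cap !memv_tangent.
have [a0 eA] := point_vpick A; have [c0 eC] := point_vpick C.
have [v0 eV] := point_vpick V.
have qa := onA _ (memv_pick A); have qc := onC _ (memv_pick C).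
have := memv_pick V; rewrite memV => /andP[/eqP av /eqP cv].
set a := vpick A in a0 eA qa av memV *; set c := vpick C in c0 eC qc cv memV *.
set v := vpick V in v0 eV av cv *.
(* If a and c were conjugate, both would lie on both tangents, hence on the
   point V. *)
have g0 : polar Q a c != 0.
  apply: contra AC => /eqP ac; apply/eqP/val_inj => /=.
  have aV : a \in point_space V.
    by rewrite memV polar_diag qa mulr0 polarC ac eqxx.
  have cV : c \in point_space V by rewrite memV polar_diag qc mulr0 ac eqxx.
  by rewrite eA eC -(point_lineE aV a0) -(point_lineE cV c0).
(* Pairing with a leaves only the z term and pairing with c only the x term; then y v = 0. *)
have free_avc x y z : frame a v c x y z = 0 -> [/\ x = 0, y = 0 & z = 0].
  move=> f0; have pol u : polar Q u (frame a v c x y z) = 0.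
    by rewrite f0 -(scale0r 0) polarZr mul0r.
  have z0 : z = 0.
    have := pol a; rewrite !polarDr !polarZr polar_diag qa av !mulr0 !add0r.
    by move/eqP; rewrite mulf_eq0 (negPf g0) orbF => /eqP.
  have x0 : x = 0.
    have := pol c; rewrite !polarDr !polarZr polar_diag qc cv !mulr0 !addr0.
    by move/eqP; rewrite polarC mulf_eq0 (negPf g0) orbF => /eqP.
  move: f0; rewrite /frame x0 z0 !scale0r add0r addr0 => /eqP.
  by rewrite scaler_eq0 (negPf v0) orbF => /eqP.
(* Otherwise v would be conjugate to the whole basis a, v, c, so its gradient would vanish at a
   point of the smooth conic. *)
have h0 : qform Q v != 0.
  apply/eqP => qv; have /eqP[] := smoothQ v v0 qv.
  apply/rowP => i; rewrite [RHS]mxE.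
  have -> : gradient Q v 0 i = polar Q v (delta_mx 0 i).
    by rewrite /polar trmx_delta -colE [RHS]mxE.
  have [x [y [z ->]]] := free_frame_surj (delta_mx 0 i) free_avc.
  rewrite !polarDr !polarZr polar_diag qv !(polarC Q v) av cv.
  by rewrite !mulr0 !addr0.
(* This multiple of a normalizes its polar product with c to [- qform Q v]. *)
exists (- qform Q v / polar Q a c *: a), v, c; split=> //.
  split; rewrite ?qformZ ?polarZl ?qa ?av ?mulr0 //.
  by rewrite mulfVK.
apply: point_lineE; first by rewrite memvZ ?memv_pick.
by rewrite scaler_eq0 negb_or a0 mulf_neq0 ?oppr_eq0 ?invr_eq0.
Qed.

Lemma frame1_neq0 (F : fieldType) (Q : 'M[F]_3) a v c y z :
  conic_frame Q a v c -> frame a v c 1 y z != 0.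
Proof.
move=> fr; apply/eqP; rewrite -(frame000 a v c) => /(frame_inj fr) [/eqP].
by rewrite oner_eq0.
Qed.

(** If x = 0, then y^2 = x z forces y = 0, which is the excluded point C; otherwise t = y / x. *)
Lemma conic_param_surj (F : fieldType) (Q : 'M[F]_3) a v c (C P : point F) :
  conic_frame Q a v c -> point_space C = <[c]>%VS -> on_conic Q P -> P != C ->
  exists t, point_space P = <[conic_param a v c t]>%VS.
Proof.
move=> fr eC onP PC; have [p0 _] := point_vpick P; have pP := memv_pick P.
have [_ _ _ _ [_ h0]] := fr.
have [x [y [z ep]]] := frame_surj (vpick P) fr; rewrite {}ep in p0 pP.
have := onP _ pP; rewrite (qform_frame _ _ _ fr) => /eqP.
rewrite mulf_eq0 (negPf h0) subr_eq0 /= => /eqP yxz.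
have [x0|x0] := eqVneq x 0.
  move: yxz; rewrite x0 mul0r => /eqP; rewrite expf_eq0 /= => /eqP y0.
  case/eqP: PC; apply: val_inj => /=; rewrite (point_lineE pP p0).
  apply/esym/point_lineE => //; rewrite eC x0 y0 /frame !scale0r !add0r.
  by rewrite memvZ ?memv_line.
exists (y / x); apply: point_lineE; last exact: frame1_neq0 fr.
have -> : conic_param a v c (y / x) = x^-1 *: frame a v c x y z.
  rewrite -[RHS]addr0 -(scale0r (frame a v c 0 0 0)) frame_lincomb.
  by congr frame; field: yxz.
by rewrite memvZ.
Qed.

Lemma mem_polar_lineE (F : fieldType) (Q : 'M[F]_3) a v c x y z y0 m :
  conic_frame Q a v c ->
  frame a v c x y z \in (<[v]> + <[frame a v c 1 y0 m]>)%VS -> z = m * x.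
Proof.
move=> fr; rewrite -{2}(frame010 a v c) => /memv_line2P[k [l]].
by rewrite frame_lincomb => /(frame_inj fr) [-> _ ->]; ring.
Qed.

Lemma dim_join_points (F : fieldType) (P Q : point F) : (\dim (P + Q) <= 2)%N.
Proof.
case: P Q => [U /= /eqP dU] [W /= /eqP dW].
by apply: leq_trans (dimv_add_leqif U W) _; rewrite dU dW.
Qed.

(** * The ricochet configuration in parameters *)

Lemma ricochet_pascals (k : fieldType) (K : 'M[k]_3)
    (A B C D E F V W Z : point k) :
  smooth_conic K ->
  (forall P : point k, P \in [:: A; B; C; D; E; F] -> on_conic K P) ->
  uniq [:: A; B; C; D; E; F] ->
  point_space V = (tangent K A :&: tangent K C)%VS ->
  second_intersection K (V + D)%VS D F ->
  point_space W = ((A + F) :&: (C + D))%VS ->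
  second_intersection K (V + B)%VS B Z ->
  second_intersection K (W + Z)%VS Z E ->
  pascal A B C F E D = (V + W)%VS /\ pascal A E C D B F = (V + W)%VS.
Proof.
move=> smoothK onK + defV defF defW defZ defE.
rewrite /= !inE !negb_or -!andbA => /and5P[AB AC AD AE].
case/and5P=> AF BC BD BE /and5P[BF CD CE CF /and4P[DE DF EF _]].
have [onA onB onC] : [/\ on_conic K A, on_conic K B & on_conic K C].
  by split; apply: onK; rewrite !inE eqxx ?orbT.
have [onD onE onF] : [/\ on_conic K D, on_conic K E & on_conic K F].
  by split; apply: onK; rewrite !inE eqxx ?orbT.
have [a [v [c [fr eA eV eC]]]] := conic_frame_exists smoothK onA onC AC defV.
have [_ _ _ _ [_ h0]] := fr.
have eA0 : point_space A = <[conic_param a v c 0]>%VS by rewrite conic_param0.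
have [b eB] := conic_param_surj fr eC onB BC.
have [d eD] : exists t, point_space D = <[conic_param a v c t]>%VS.
  by apply: conic_param_surj fr eC onD _; rewrite eq_sym.
have [e eE] : exists t, point_space E = <[conic_param a v c t]>%VS.
  by apply: conic_param_surj fr eC onE _; rewrite eq_sym.
have [f eF] : exists t, point_space F = <[conic_param a v c t]>%VS.
  by apply: conic_param_surj fr eC onF _; rewrite eq_sym.
have param_neq P P' s t : P != P' ->
    point_space P = <[conic_param a v c s]>%VS ->
    point_space P' = <[conic_param a v c t]>%VS -> t != s.
  move=> PP eP eP'; apply: contra PP => /eqP ts.
  by apply/eqP/val_inj; rewrite /= eP eP' ts.
(* The line VD is z = d^2 x, so f^2 = d^2, and f = d is excluded by D and F being distinct. *)
have ef : f = - d.
  have [/subvP FVD _] : (F <= V + D)%VS /\ on_conic K F.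
    by apply: intersection_mult_gt0; rewrite defF eqxx addn1.
  have : conic_param a v c f \in (V + D)%VS.
    by apply: FVD; rewrite eF memv_line.
  rewrite eV eD => /(mem_polar_lineE fr)/eqP; rewrite mulr1 eqf_sqr.
  by rewrite (negPf (param_neq _ _ _ _ DF eD eF)) => /eqP.
rewrite {f}ef in eF.
have d0 := param_neq _ _ _ _ AD eA0 eD.
have b0 := param_neq _ _ _ _ AB eA0 eB.
have e0 := param_neq _ _ _ _ AE eA0 eE.
(* In characteristic 2 the parameters d and - d would agree, and D would equal F. *)
have two0 : 2 != 0 :> k.
  apply: contra (param_neq _ _ _ _ DF eD eF) => /eqP two.
  by rewrite -subr_eq0 -opprD -mulr2n -mulr_natl two mul0r oppr0.
have [ZVB onZ] : (Z <= V + B)%VS /\ on_conic K Z.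
  by apply: intersection_mult_gt0; rewrite defZ eqxx addn1.
have eZ : point_space Z = <[conic_param a v c (- b)]>%VS.
  have [|z eZ] := @conic_param_surj _ K a v c C Z fr eC onZ.
    (* The line VB is z = b^2 x, which misses (0, 0, 1). *)
    apply/eqP => ZC.
    have : frame a v c 0 0 1 \in (V + B)%VS.
      by apply: (subvP ZVB); rewrite ZC eC frame001 memv_line.
    rewrite eV eB => /(mem_polar_lineE fr)/eqP.
    by rewrite mulr0 oner_eq0.
  have : conic_param a v c z \in (V + B)%VS.
    by apply: (subvP ZVB); rewrite eZ memv_line.
  rewrite eV eB => /(mem_polar_lineE fr)/eqP; rewrite mulr1 eqf_sqr.
  case/orP=> /eqP zb; last by rewrite eZ zb.
  (* Otherwise VB would be tangent at B, and B would lie on the polar AC of V. *)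
  have ZB : Z = B by apply: val_inj; rewrite /= eZ eB zb.
  have mB : (1 < intersection_mult K (V + B) B)%N by rewrite defZ ZB eqxx.
  have : polar K (conic_param a v c b) (frame a v c 0 1 0) = 0.
    apply: (intersection_mult_gt1 (dim_join_points V B) mB).
      by rewrite eB memv_line.
    by apply: (subvP (addvSl _ _)); rewrite eV frame010 memv_line.
  rewrite (polar_frame _ _ _ _ _ _ fr) !mulr0 !mulr1 !subr0 => /eqP.
  by rewrite !mulf_eq0 (negPf h0) (negPf two0) (negPf b0).
have eW : point_space W = <[frame a v c 1 d (- d ^+ 2)]>%VS.
  apply: point_lineE; last exact: frame1_neq0 fr.
  rewrite defW memv_cap eA0 eF eC eD; apply/andP; split; apply/memv_line2P.
    by exists 2, (-1); rewrite frame_lincomb; congr frame; ring.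
  exists (- (2 * d ^+ 2)), 1.
  by rewrite -{2}(frame001 a v c) frame_lincomb; congr frame; ring.
have rel : e * (b + d) = d * (b - d).
  (* If E = Z, collinearity says nothing; multiplicity two makes W conjugate to Z, and this is the
     relation at e = - b. *)
  have [eb|eb] := eqVneq e (- b).
    have EZ : E = Z by apply: val_inj; rewrite /= eE eZ eb.
    have mZ : (1 < intersection_mult K (W + Z) Z)%N by rewrite defE EZ eqxx.
    have : polar K (conic_param a v c (- b)) (frame a v c 1 d (- d ^+ 2)) = 0.
      apply: (intersection_mult_gt1 (dim_join_points W Z) mZ).
        by rewrite eZ memv_line.
      by apply: (subvP (addvSl _ _)); rewrite eW memv_line.
    rewrite (polar_frame _ _ _ _ _ _ fr) => /eqP.
    rewrite mulf_eq0 (negPf h0) /= => /eqP tang; apply: subr0_eq.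
    by rewrite -tang eb; ring.
  have [EWZ _] : (E <= W + Z)%VS /\ on_conic K E.
    by apply: intersection_mult_gt0; rewrite defE eqxx addnS.
  have : conic_param a v c e \in (W + Z)%VS.
    by apply: (subvP EWZ); rewrite eE memv_line.
  rewrite eW eZ => /memv_line2P[m [l]].
  rewrite frame_lincomb => /(frame_inj fr) [h1 h2 h3].
  have el : l = 1 - m by rewrite h1; ring.
  have m0 : m != 0.
    by apply: contra eb => /eqP m0; rewrite h2 el m0; apply/eqP; ring.
  (* With e = m (b + d) - b, the equation for e^2 is m times the relation; the root m = 0 is Z
     itself. *)
  apply: (mulfI m0); apply: subr0_eq.
  transitivity (e ^+ 2 - (m * 1 * - d ^+ 2 + l * (- b) ^+ 2)).
    by rewrite h2 el; ring.
  by rewrite h3 !mulr1 subrr.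
have bD0 : b + d != 0.
  by rewrite addr_eq0 eq_sym; exact: (param_neq _ _ _ _ BF eB eF).
have bd : b != d by rewrite eq_sym; exact: (param_neq _ _ _ _ BD eB eD).
have ed : e != d by exact: (param_neq _ _ _ _ DE eD eE).
have eNd : e != - d by rewrite eq_sym; exact: (param_neq _ _ _ _ EF eE eF).
rewrite eV eW polar_line_shift; split.
  exact: (pascal_conic_frame fr eA eC eB eD eE eF).
(* Now E, F, B, D play the roles of B, D, E, G, with parameters e, - d, b and - - d; the line VW
   depends only on d^2. *)
rewrite -[d]opprK in eD; rewrite -sqrrN.
apply: (pascal_conic_frame fr eA eC eE eF eB eD) => //.
- by rewrite oppr_eq0.
- by rewrite -addr_eq0.
- by rewrite subr_eq0.
by apply: subr0_eq; rewrite -(subrr (e * (b + d))) {2}rel; ring.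
Qed.

Theorem proposition3p2 (R : realType) (K : 'M[complex R]_3)
    (A B C D E F V W Z : point (complex R))
    (smoothK : smooth_conic K)
    (onK : forall P : point (complex R),
       P \in [:: A; B; C; D; E; F] -> on_conic K P)
    (distinct : uniq [:: A; B; C; D; E; F])
    (defV : point_space V = (tangent K A :&: tangent K C)%VS)
    (defF : second_intersection K (V + D)%VS D F)
    (defW : point_space W = ((A + F) :&: (C + D))%VS)
    (defZ : second_intersection K (V + B)%VS B Z)
    (defE : second_intersection K (W + Z)%VS Z E) :
  pascal A B C F E D = (V + W)%VS /\ pascal A E C D B F = (V + W)%VS.
Proof.
exact: (ricochet_pascals smoothK onK distinct defV defF defW defZ defE).
Qed.
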